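(* Let $A$ be a finite Abelian group generated by two elements such that $A/2A\cong\mathbb{Z}/2\mathbb{Z}\oplus\mathbb{Z}/2\mathbb{Z}$. Suppose $|A|=4p_{1}^{k_{1}}p_{2}^{k_{2}}\cdots p_{n}^{k_{n}}$, where each $p_{i}$ is a prime with $p_{i}\geq 13$, the $k_i$ are non-negative integers, and $k_{1}+k_{2}+\cdots+k_{n}\geq 1$. Then $A$ does not contain a nonseparating subset.
   Context: Coset numbers. Let $A$ be a finite Abelian group and let $H\subseteq A$ be a disjoint union of four sets $\{\pm h_1\},\{\pm h_2\},\{\pm h_3\},\{\pm h_4\}$ (it is allowed that $h_i=-h_i$). Let $B$ be a subgroup of $A$ such that $A/B$ is cyclic of order $n$, and let $a\in A$ be such that $a+B$ generates $A/B$. For each $k\in\{1,2,3,4\}$ there is a unique integer $c$ with $0\le c\le n/2$ and $(ca+B)\cap\{\pm h_k\}\neq\emptyset$. These four integers, ordered so that $0\le c_1\le c_2\le c_3\le c_4$ (with repetitions allowed), are the coset numbers for $H$ relative to $B$ and the generator $a+B$ of $A/B$. Nonseparating subset. A subset $H$ of a finite Abelian group $A$ is called nonseparating if (i) $H$ is a disjoint union $H=H_1\coprod H_2\coprod H_3\coprod H_4$ where each $H_i=\{\pm h_i\}$ (possibly $h_i=-h_i$), and (ii) for every cyclic subgroup $B$ of $A$ such that $A/B$ is cyclic and every generator $a+B$ of $A/B$, the coset numbers $c_1\le c_2\le c_3\le c_4$ for $H$ relative to $B$ and $a+B$ satisfy $c_2=c_3$. *)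

(* Defs.v *)
From HB Require Import structures.
From mathcomp Require Import all_boot all_order all_algebra.
From mathcomp Require Import all_fingroup all_solvable zify.

Set Implicit Arguments.
Unset Strict Implicit.
Unset Printing Implicit Defensive.

Local Open Scope group_scope.

(* Finite Abelian groups are written multiplicatively, as subgroups A of an
   ambient finGroupType: -h is h^-1, ca + B is (a ^+ c) *: B, and 2A is the
   group of squares. *)

Definition pm (gT : finGroupType) (h : gT) : {set gT} := [set h; h^-1].

(* When A is abelian the squares already form a subgroup, and the closure
   <<_>> only supplies the group structure: see squaresE. *)
Definition squares (gT : finGroupType) (A : {set gT}) : {set gT} :=
  <<[set x ^+ 2 | x in A]>>.

Definition is_coset_number (gT : finGroupType) (A B : {set gT}) (a h : gT)
    (c : nat) : bool :=
  (c.*2 <= #|A / B|) && (a ^+ c *: B :&: pm h != set0).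

(* The least c satisfying is_coset_number; coset_numberP and
   coset_number_unique show that it is the only one. *)
Definition coset_number (gT : finGroupType) (A B : {set gT}) (a h : gT) : nat :=
  find (is_coset_number A B a h) (iota 0 #|A / B|).

Definition coset_numbers (gT : finGroupType) (A B : {set gT}) (a : gT)
    (h : 'I_4 -> gT) : seq nat :=
  sort leq [seq coset_number A B a (h k) | k : 'I_4].

Definition pm_decomposition (gT : finGroupType) (H : {set gT})
    (h : 'I_4 -> gT) : Prop :=
  H = \bigcup_(k < 4) pm (h k) /\
  (forall i j : 'I_4, i != j -> [disjoint pm (h i) & pm (h j)]).

(* Sequences are indexed from 0, so c_2 = c_3 compares entries 1 and 2. *)
Definition nonseparating (gT : finGroupType) (A : {group gT}) (H : {set gT}) :
    Prop :=
  H \subset A /\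
  exists2 h : 'I_4 -> gT, pm_decomposition H h &
    forall B : {group gT}, B \subset A -> cyclic B -> cyclic (A / B) ->
    forall a : gT, a \in A -> generator (A / B) (coset B a) ->
      nth 0%N (coset_numbers A B a h) 1%N =
      nth 0%N (coset_numbers A B a h) 2.

Lemma squaresE (gT : finGroupType) (A : {group gT}) :
  abelian A -> squares A = [set x ^+ 2 | x in A].
Proof.
move=> abA; apply: gen_set_id; apply/group_setP; split.
  by apply/imsetP; exists 1; rewrite ?group1 ?expg1n.
move=> _ _ /imsetP[x Ax ->] /imsetP[y Ay ->].
by apply/imsetP; exists (x * y); rewrite ?groupM // expgMn //; apply: (centsP abA).
Qed.

Lemma is_coset_numberE (gT : finGroupType) (A B : {group gT}) (a h : gT) c :
  abelian A -> B \subset A -> a \in A -> h \in A ->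
  is_coset_number A B a h c =
  (c.*2 <= #|A / B|) && ((coset B h == coset B a ^+ c) ||
                         (coset B h == coset B a ^- c)).
Proof.
move=> abA sBA Aa Ah; congr (_ && _).
have nBA : A \subset 'N(B) := sub_abelian_norm abA sBA.
have inB x y : x \in A -> y \in A ->
    (y \in x *: B) = (coset B y == coset B x).
  move=> Ax Ay; have Nx := subsetP nBA x Ax; have Ny := subsetP nBA y Ay.
  by rewrite -norm_rlcoset // eq_sym; apply/idP/eqP => [/rcoset_kercosetP|e];
     [move=> <- | apply/rcoset_kercosetP].
have Aac : a ^+ c \in A by rewrite groupX.
have Nh := subsetP nBA h Ah.
rewrite -morphX ?(subsetP nBA) //.
rewrite -morphV ?(subsetP nBA) //.
have -> : (coset B h == coset B (a ^+ c)^-1) = (coset B h^-1 == coset B (a ^+ c)).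
  by rewrite !morphV ?(subsetP nBA) // eq_invg_sym eq_sym.
rewrite -!inB ?groupV //.
apply/set0Pn/orP => [[x] | [] hx].
- rewrite !inE => /andP[xB /orP[]/eqP e]; rewrite -e; [by left | by right].
- by exists h; rewrite !inE hx eqxx.
- by exists h^-1; rewrite !inE hx eqxx orbT.
Qed.

Lemma coset_numberP (gT : finGroupType) (A B : {group gT}) (a h : gT) :
  abelian A -> B \subset A -> a \in A -> h \in A ->
  generator (A / B) (coset B a) ->
  is_coset_number A B a h (coset_number A B a h).
Proof.
move=> abA sBA Aa Ah gen.
have n0 : 0 < #|A / B| by apply: cardG_gt0.
have on : #[coset B a] = #|A / B| by rewrite orderE -(eqP gen).
suff hasc : has (is_coset_number A B a h) (iota 0 #|A / B|).
  have := nth_find 0 hasc; rewrite nth_iota ?add0n //.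
  by move: hasc; rewrite has_find size_iota.
have : coset B h \in <[coset B a]> by rewrite -(eqP gen) mem_quotient.
case/cyclePmin => m; rewrite on => ltm e.
have [le|gt] := leqP m.*2 #|A / B|.
  apply/hasP; exists m; first by rewrite mem_iota.
  by rewrite is_coset_numberE // le e eqxx.
have ltn : #|A / B| - m < #|A / B|.
  by rewrite ltn_subrL n0 andbT; case: (m) gt.
apply/hasP; exists (#|A / B| - m); first by rewrite mem_iota.
rewrite is_coset_numberE //; apply/andP; split; first lia.
apply/orP; right; rewrite e eq_sym eq_invg_mul -expgD subnK ?(ltnW ltm) //.
by rewrite -on expg_order.
Qed.

Lemma coset_number_unique (gT : finGroupType) (A B : {group gT}) (a h : gT) c d :
  abelian A -> B \subset A -> a \in A -> h \in A ->
  generator (A / B) (coset B a) ->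
  is_coset_number A B a h c -> is_coset_number A B a h d -> c = d.
Proof.
move=> abA sBA Aa Ah gen; rewrite !is_coset_numberE //.
have n0 : 0 < #|A / B| by apply: cardG_gt0.
have on : #[coset B a] = #|A / B| by rewrite orderE -(eqP gen).
have small x : x.*2 <= #|A / B| -> x < #|A / B|.
  case: x => // x; apply: leq_trans; rewrite -addnn addSn ltnS; exact: leq_addl.
have same x y : x.*2 <= #|A / B| -> y.*2 <= #|A / B| ->
    coset B a ^+ x = coset B a ^+ y -> x = y.
  move=> lx ly /eqP; rewrite eq_expg_mod_order on !modn_small ?small //.
  by move/eqP.
have opp x y : x.*2 <= #|A / B| -> y.*2 <= #|A / B| ->
    coset B a ^+ x = coset B a ^- y -> x = y.
  move=> lx ly e; have : #|A / B| %| x + y.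
    by rewrite -on order_dvdn expgD e mulVg.
  case: (posnP (x + y)) => [|pxy /(dvdn_leq pxy)]; lia.
move=> /andP[lc /orP[]/eqP ec] /andP[ld /orP[]/eqP ed].
- by apply: same; rewrite // -ec -ed.
- by apply: opp; rewrite // -ec -ed.
- by apply/esym/opp; rewrite // -ec -ed.
- by apply: same => //; apply: invg_inj; rewrite -ec -ed.
Qed.

(* Main.v *)
Require Import Defs.
From HB Require Import structures.
From mathcomp Require Import all_boot all_order all_algebra.
From mathcomp Require Import all_fingroup all_solvable.
From mathcomp Require Import zify.

Set Implicit Arguments.
Unset Strict Implicit.
Unset Printing Implicit Defensive.

(** Write A = <X> x <Y> with |Y| dividing |X|.  The hypotheses make both orders
    twice an odd number, |X| = 2e and |Y| = 2d, so that A = T x M with T the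
    Klein four-group of involutions and M = <X^2> x <Y^2> of odd order ed.
    Suppose that h_1, ..., h_4 represent a nonseparating subset.

    Choice of a cyclic subgroup.  The d-th powers of x^(rt) y, for x = X^2,
    y = Y^2, r = e / d, are trivial, these elements generate complements of <x>
    in M, and for t = 0, ..., 12 the thirteen cyclic groups that they generate
    meet pairwise trivially, because 1, ..., 12 are prime to ed (twist_meet).
    The elements h_k h_l^(-1) and h_k h_l with k < l are twelve nontrivial
    elements, so one of the thirteen groups, say <b>, contains none of them
    (avoid_sums_differences).  Modulo <b> every h_k has a coordinate u_k in T
    and a coordinate 2 i_k in Z/e, and by the choice of b the four pairs
    (u_k, |i_k|) are distinct, where |i| is the distance of i to eZ.

    Coset numbers.  For a nontrivial character chi of T, with kernel <s> and
    with chi(s') = 1, take B = <s b> and the generator s' x of A / B, which is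
    cyclic of order 2e.  The coset number of h_k is then 2|i_k| or e - 2|i_k|,
    according to chi(u_k) (frame_coset_number).  Since e is odd, its parity
    shows chi(u_k) and its value then shows |i_k|.  Replacing x by an n-th root
    of x, with n prime to e, replaces each i_k by n i_k.

    Contradiction.  The equality c_2 = c_3 yields, for each of the three
    characters, two indices with the same |i| on which chi agrees.  Three
    2-subsets of a 4-set cannot be pairwise disjoint, hence three of the indices
    share a value |i| = X and have distinct u (triple_exists); let Y be the
    value of the fourth.  Some character takes each of its values on exactly two
    of the u_k (chi_split), and for it the coset numbers are X' , X' , e - X',
    e - Y' up to reflection, with X' = 2X and Y' = 2Y.  That the two middle ones
    agree forces X and (X + Y) / 2 to lie strictly on opposite sides of e / 4.
    This holds for all multiples of the i_k by numbers prime to e, but the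
    multiples by 1, 2, 3, 4, 6 rule it out (not_always_opposite). *)

(** * Distance to the multiples of a modulus *)

(** The absolute value of i in Z/N. *)
Definition absmod N i := minn (i %% N) (N - i %% N).

Lemma absmod_half N i : 0 < N -> (absmod N i).*2 <= N.
Proof. by move=> N0; rewrite /absmod; have := ltn_pmod i N0; lia. Qed.

Lemma absmodP N i : 0 < N -> i = absmod N i %[mod N] \/ N %| i + absmod N i.
Proof.
move=> N0; rewrite /absmod; have [_|_] := leqP (i %% N) (N - i %% N).
  by left; rewrite modn_mod.
right; rewrite /dvdn -modnDml subnKC ?modnn //; exact/ltnW/ltn_pmod.
Qed.

Lemma absmod_eq N i c :
  c.*2 <= N -> i = c %[mod N] \/ N %| i + c -> absmod N i = c.
Proof.
case: N => [|N] hc; first by rewrite /absmod; lia.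
rewrite /absmod => -[->|]; first by rewrite modn_small; lia.
rewrite /dvdn -modnDml; have := ltn_pmod i (ltn0Sn N).
move: (i %% N.+1) => r ltr /dvdnP[q eq].
by have {eq} : r + c = 0 \/ r + c = N.+1; [case: q eq => [|[|q]]; nia | lia].
Qed.

Lemma absmodM N s i : 0 < N -> absmod N (s * i) = absmod N (s * absmod N i).
Proof.
move=> N0; apply: absmod_eq; first exact: absmod_half.
have dvdE u v : (u = v %[mod N]) -> forall w, (N %| u + w) = (N %| v + w).
  by move=> e w; rewrite /dvdn -modnDml e modnDml.
have [e|e] := absmodP i N0; have [e'|e'] := absmodP (s * absmod N i) N0.
- by left; rewrite -modnMmr e modnMmr.
- by right; rewrite (dvdE _ (s * absmod N i)) // -modnMmr e modnMmr.
- right; rewrite addnC (dvdE _ (s * absmod N i)) // addnC -mulnDr.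
  by rewrite dvdn_mull.
- left; apply/eqP; rewrite -(eqn_modDr (s * absmod N i)) -mulnDr.
  by rewrite [X in _ == X %[mod _]]addnC (eqP e') -/(_ %| _) dvdn_mull.
Qed.

Lemma absmod_inj N i j :
  0 < N -> absmod N i = absmod N j -> i = j %[mod N] \/ N %| i + j.
Proof.
move=> N0 eij; have [ei|ei] := absmodP i N0; have [ej|ej] := absmodP j N0.
- by left; rewrite ei ej eij.
- by right; rewrite /dvdn -modnDml ei eij modnDml addnC.
- by right; rewrite /dvdn -modnDmr ej -eij modnDmr.
left; apply/eqP; rewrite -(eqn_modDr (absmod N i)) (eqP ei) [in X in _ == X]eij.
by rewrite (eqP ej).
Qed.

(** The absolute value in Z/2e of a class congruent to t modulo 2 and to 2y or
    -2y modulo e, for e odd and y at most e/2. *)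
Definition level e (t : bool) y := if t then e - y.*2 else y.*2.

(** The parity of the level is t, so coset numbers of different parity never
    coincide. *)
Lemma level_inj e t t' y y' : odd e -> y.*2 <= e -> y'.*2 <= e ->
  level e t y = level e t' y' -> t = t' /\ y = y'.
Proof. by rewrite /level; case: t; case: t'; lia. Qed.

Lemma absmod_level e (t : bool) i :
  odd e -> absmod e.*2 (i.*2 + t * e) = level e t (absmod e i).
Proof.
move=> oe; have e0 : 0 < e by case: e oe.
have := absmod_half i e0; have := absmodP i e0; move: (absmod e i) => y yP le_y.
apply: absmod_eq; rewrite /level; first by case: t; lia.
have dvd2 u : e %| u -> e.*2 %| u.*2 by rewrite -!muln2 dvdn_pmul2r.
have mod2 u v : u = v %[mod e] -> u.*2 = v.*2 %[mod e.*2].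
  by move=> euv; rewrite -!muln2 -!muln_modl euv.
case: t; case: yP => [/mod2|/dvd2]; rewrite ?mul1n ?mul0n ?addn0.
- move=> h; right.
  have -> : i.*2 + e + (e - y.*2) = i.*2 + (e.*2 - y.*2) by lia.
  by rewrite /dvdn -modnDml h modnDml subnKC ?modnn //; lia.
- rewrite doubleD => h; left.
  apply/eqP; rewrite -(eqn_modDr y.*2) addnAC subnK //.
  by rewrite -[X in _ == X %[mod _]]add0n eqn_modDr mod0n.
- by left.
- by rewrite -doubleD; right.
Qed.

Lemma absmod2 N y : y.*2 <= N ->
  absmod N (2 * y) = if 4 * y <= N then 2 * y else N - 2 * y.
Proof.
move=> hy; case: leqP => h; (apply: absmod_eq; first lia); first by left.
by right; rewrite subnKC ?dvdnn //; lia.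
Qed.

Lemma absmod3 N y : y.*2 <= N ->
  absmod N (3 * y) =
    if 6 * y <= N then 3 * y else if 3 * y <= N then N - 3 * y else 3 * y - N.
Proof.
move=> hy; case: leqP => h6; last case: leqP => h3;
  (apply: absmod_eq; first lia).
- by left.
- by right; rewrite subnKC ?dvdnn.
- by left; rewrite -{1}(subnK (ltnW h3)) modnDr.
Qed.

(** X and the mean of X and Y lie strictly on opposite sides of N / 4. *)
Definition opposite N X Y := (4 * X < N) && (N < (X + Y).*2)
  || (N < 4 * X) && ((X + Y).*2 < N).

(** If X is at most N/8, then Y is within X of N/2, so that |2X| and |2Y| are
    both at most N/4; if X is at least 3N/8, then Y is less than N/2 - X, with
    the same effect.  Neither pair of doubles can be opposite. *)
Lemma opposite_double N X Y :
  X.*2 <= N -> Y.*2 <= N -> opposite N X Y ->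
  opposite N (absmod N (2 * X)) (absmod N (2 * Y)) -> N < 8 * X < 3 * N.
Proof.
move=> hX hY; rewrite !absmod2 // /opposite.
case: (leqP (4 * X) N) => ?; case: (leqP (4 * Y) N) => ?; lia.
Qed.

(** The previous lemma confines X, |2X| and |3X| to the open interval
    (N/8, 3N/8).  If X < N/4, the first two bounds give N/8 < X < 3N/16 and then
    |3X| > 3N/8; if X > N/4, they give 5N/16 < X < 3N/8, near N/3, and then
    |3X| < N/8. *)
Lemma not_always_opposite N X Y :
  X.*2 <= N -> Y.*2 <= N ->
  ~ forall s, s \in [:: 1; 2; 3; 4; 6] ->
      opposite N (absmod N (s * X)) (absmod N (s * Y)).
Proof.
move=> hX hY P; have [N0|N0] := posnP N.
  by move: (P 1 isT); rewrite N0 /opposite !ltn0 andbF.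
have dbl s : s \in [:: 1; 2; 3] -> N < 8 * absmod N (s * X) < 3 * N.
  move=> hs; apply: (@opposite_double N _ (absmod N (s * Y)));
    rewrite ?absmod_half //.
    by apply: P; move: hs; rewrite !inE => /or3P[] /eqP->.
  rewrite -!absmodM // !mulnA; apply: P.
  by move: hs; rewrite !inE => /or3P[] /eqP->.
have f1 : absmod N (1 * X) = X by apply: absmod_eq => //; left; rewrite mul1n.
move: (dbl 1 isT) (dbl 2 isT) (dbl 3 isT); rewrite f1 absmod2 // absmod3 //.
case: (leqP (4 * X) N) => ?; case: (leqP (6 * X) N) => ?;
  case: (leqP (3 * X) N) => ?; lia.
Qed.

(** * Four numbers with equal middle terms *)

(** Equality of the two middle terms m of the sorted values of c, phrased
    without sorting so that it can be evaluated on any listing of the four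
    indices. *)
Definition balanced (c : 'I_4 -> nat) := exists m,
  \sum_(k < 4) (c k < m) <= 1 /\ \sum_(k < 4) (m < c k) <= 1.

Lemma balanced_sorted (c : 'I_4 -> nat) (s := sort leq [seq c k | k : 'I_4]) :
  nth 0 s 1 = nth 0 s 2 -> balanced c.
Proof.
have ss : sorted leq s by apply: sort_sorted leq_total _.
have cnt (P : pred nat) : \sum_(k < 4) P (c k) = count P s.
  rewrite count_sort count_map -sum1_count big_enum_cond [RHS]big_mkcond.
  by apply: eq_bigr => k _ /=; case: (P _).
have sz : size s = 4 by rewrite size_sort size_map -cardE card_ord.
move=> e; exists (nth 0 s 1); rewrite (cnt (ltn^~ _)) (cnt (ltn _)).
move: sz ss e; case: {cnt} s => [|a [|b [|c' [|d []]]]] //= _.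
by rewrite andbT => /and3P[*]; lia.
Qed.

Lemma balanced_eq c : balanced c -> exists i j, i != j /\ c i = c j.
Proof.
case=> m [lo hi].
have: 1 < #|[pred k | c k == m]|.
  have: \sum_(k < 4) ((c k < m) + (m < c k) + (c k == m)) = 4.
    rewrite (eq_bigr (fun=> 1)) ?sum1_card ?card_ord // => k _; lia.
  rewrite !big_split /=.
  have -> : \sum_(k < 4) (c k == m) = #|[pred k | c k == m]|.
    rewrite -sum1_card [RHS]big_mkcond; apply: eq_bigr => k _.
    by rewrite inE; case: (c k == m).
  move: lo hi; move: (\sum_(k < 4) (c k < m)) (\sum_(k < 4) (m < c k)) => lo hi.
  lia.
by case/card_gt1P=> i [j] [/eqP ci /eqP cj nij]; exists i, j; rewrite ci cj.
Qed.

Lemma sum_I4 (F : 'I_4 -> nat) a b c d :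
  uniq [:: a; b; c; d] -> \sum_k F k = F a + F b + F c + F d.
Proof.
move=> U; have P : perm_eq (enum 'I_4) [:: a; b; c; d].
  rewrite perm_sym uniq_perm ?enum_uniq //.
  have sub : {subset [:: a; b; c; d] <= enum 'I_4}.
    by move=> k _; rewrite mem_enum.
  by have [|_] := uniq_min_size U sub; rewrite -?cardE ?card_ord.
by rewrite -big_enum (perm_big _ P) !big_cons big_nil /=; lia.
Qed.

(** * Signs of the four elements *)

(** The characters of the Klein four-group, written additively as the pairs of
    booleans; s ranges over the dual group, and the trivial character is that of
    (false, false). *)
Definition chi (s u : bool * bool) := s.1 && u.1 (+) s.2 && u.2.

(** Two distinct nontrivial characters form a basis of the dual group. *)
Lemma chi_inj s t u v : s != (false, false) -> t != (false, false) -> s != t ->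
  chi s u = chi s v -> chi t u = chi t v -> u = v.
Proof. by case: s t u v => [[] []] [[] []] [[] []] [[] []]. Qed.

(** If u4 is the remaining element of the group, every nontrivial character will
    do; otherwise u4 is one of the first three, and the character that separates
    it from the other two will do. *)
Lemma chi_split u1 u2 u3 u4 : uniq [:: u1; u2; u3] ->
  exists2 s, s != (false, false) &
    chi s u1 + chi s u2 + chi s u3 + chi s u4 = 2.
Proof.
move=> U; suff /hasP[s hs /eqP e] : has (fun s => chi s u1 + chi s u2 + chi s u3
    + chi s u4 == 2) [:: (true, false); (false, true); (true, true)].
  by exists s => //; move: hs; rewrite !inE => /or3P[] /eqP->.
by case: u1 u2 u3 u4 U => [[] []] [[] []] [[] []] [[] []].
Qed.

Definition agree (u : 'I_4 -> bool * bool) (y : 'I_4 -> nat) s i j :=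
  [/\ i != j, chi s (u i) = chi s (u j) & y i = y j].

Lemma agree_sym u y s i j : agree u y s i j -> agree u y s j i.
Proof. by case=> n c e; split; rewrite 1?eq_sym. Qed.

Definition triple (u : 'I_4 -> bool * bool) (y : 'I_4 -> nat) :=
  exists a b c, [/\ y a = y b, y a = y c, uniq [:: a; b; c]
    & uniq [:: u a; u b; u c]].

Section Triple.
Variables (u : 'I_4 -> bool * bool) (y : 'I_4 -> nat).
Hypothesis uy_inj : forall i j, u i = u j -> y i = y j -> i = j.

(** The two characters together separate points, so b = c would give a and b
    the same sign and the same value of y. *)
Lemma triple_path s t a b c :
    s != (false, false) -> t != (false, false) -> s != t ->
  agree u y s a b -> agree u y t a c -> triple u y.
Proof.
move=> s0 t0 st [ab sab yab] [ac tac yac].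
have nu i j : y i = y j -> i != j -> u i != u j.
  by move=> yij; apply: contra_neq => uij; apply: uy_inj.
have bc : b != c.
  apply: contra_neq ab => ebc; apply: uy_inj => //.
  by apply: (chi_inj s0 t0 st sab); rewrite ebc.
exists a, b, c; split=> //=; rewrite !inE negb_or ?ab ?ac ?bc //.
by rewrite !nu // -yab.
Qed.

Lemma triple_meet s t i j k l :
    agree u y s i j -> agree u y t k l ->
    s != (false, false) -> t != (false, false) -> s != t ->
  triple u y \/ [disjoint [set i; j] & [set k; l]].
Proof.
move=> aij akl s0 t0 st; have [|/pred0Pn[x]] := boolP [disjoint _ & _].
  by right.
have [aji alk] := (agree_sym aij, agree_sym akl).
rewrite !inE => /andP[] /orP[]/eqP-> /orP[]/eqP e; left.
- by rewrite e in aij; apply: triple_path s0 t0 st aij akl.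
- by rewrite e in aij; apply: triple_path s0 t0 st aij alk.
- by rewrite e in aji; apply: triple_path s0 t0 st aji akl.
- by rewrite e in aji; apply: triple_path s0 t0 st aji alk.
Qed.

(** Three pairwise disjoint pairs do not fit in four indices, so two of the
    three pairs share an index. *)
Lemma triple_exists :
  (forall s, s != (false, false) -> exists i j, agree u y s i j) -> triple u y.
Proof.
move=> H; have [i1 [j1 P1]] := H (true, false) isT.
have [i2 [j2 P2]] := H (false, true) isT.
have [i3 [j3 P3]] := H (true, true) isT.
have [//|D12] := triple_meet P1 P2 isT isT isT.
have [//|D13] := triple_meet P1 P3 isT isT isT.
have [//|D23] := triple_meet P2 P3 isT isT isT.
have := max_card ([set i1; j1] :|: [set i2; j2] :|: [set i3; j3]).
case: P1 P2 P3 => [n1 _ _] [n2 _ _] [n3 _ _].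
rewrite (cardsU _ [set i3; j3]) (cardsU [set i1; j1]) (setIUl [set i1; j1]).
rewrite (disjoint_setI0 D12) (disjoint_setI0 D13) (disjoint_setI0 D23).
rewrite setU0 cards0 !subn0.
by rewrite !cards2 n1 n2 n3 card_ord.
Qed.

End Triple.

(** The combinatorial core: u k is the sign of the k-th element in the Klein
    four-group, i k its coordinate in Z/e, and n runs over the changes of
    generator of Z/e. *)
Lemma not_all_balanced e (u : 'I_4 -> bool * bool) (i : 'I_4 -> nat) :
    odd e -> coprime 3 e ->
    (forall k l, u k = u l -> absmod e (i k) = absmod e (i l) -> k = l) ->
  ~ forall s n, s != (false, false) -> coprime n e ->
      balanced (fun k => level e (chi s (u k)) (absmod e (n * i k))).
Proof.
move=> oe co3 inj H; have e0 : 0 < e by case: e oe {inj co3 H}.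
have [s s0|a [b [c [yab yac Uabc Uu]]]] := triple_exists inj.
  have := H s 1 s0 (coprime1n _) => /balanced_eq[k [l [kl eq]]]; exists k, l.
  rewrite !mul1n in eq.
  by have [||? ?] := level_inj oe _ _ eq; rewrite ?absmod_half.
have [d Ud] : exists d, uniq [:: a; b; c; d].
  have [d nd|all_abc] := pickP [predC [:: a; b; c]].
    exists d; rewrite -[uniq _]/(uniq (rcons [:: a; b; c] d)).
    by rewrite rcons_uniq Uabc andbT.
  have sub : {subset enum 'I_4 <= [:: a; b; c]}.
    by move=> k _; apply/negPn; rewrite (all_abc k : (k \notin _) = false).
  by have := uniq_leq_size (enum_uniq 'I_4) sub; rewrite -cardE card_ord.
have [s s0 sum2] := chi_split (u d) Uu.
apply: (@not_always_opposite e (absmod e (i a)) (absmod e (i d)));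
  rewrite ?absmod_half //.
move=> n hn; have con : coprime n e.
  have co2 : coprime 2 e by rewrite coprime2n.
  have co4 : coprime (2 * 2) e by rewrite coprimeMl co2.
  have co6 : coprime (2 * 3) e by rewrite coprimeMl co2.
  by move: hn; rewrite !inE => /or4P[|||/orP[]] /eqP->; rewrite ?coprime1n.
have [m []] := H s n s0 con.
rewrite !(sum_I4 _ Ud) !(absmodM _ (i _)) // -yab -yac.
have := absmod_half (n * absmod e (i a)) e0.
have := absmod_half (n * absmod e (i d)) e0.
move: (absmod e (n * _)) (absmod e _) => X Y hY hX.
move: sum2; rewrite /level /opposite.
by case: (chi s (u a)); case: (chi s (u b));
  case: (chi s (u c)); case: (chi s (u d)) => //= _; lia.
Qed.

Local Open Scope group_scope.

(** * Coset numbers relative to a cyclic complement *)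

Section Complement.
Variables (gT : finGroupType) (A : {group gT}) (a b : gT).
Hypotheses (abA : abelian A) (Aa : a \in A) (Ab : b \in A).
Hypotheses (sAab : A \subset <[a]> * <[b]>) (oA : #|A| = (#[a] * #[b])%N).

Let sbA : <[b]> \subset A. Proof. by rewrite cycle_subG. Qed.
Let nbA : A \subset 'N(<[b]>). Proof. exact: sub_abelian_norm. Qed.

Lemma generator_complement : generator (A / <[b]>) (coset <[b]> a).
Proof.
have defA : <[a]> * <[b]> = A.
  by apply/eqP; rewrite eqEsubset sAab mul_subG ?cycle_subG.
by rewrite /generator -{1}defA quotientMidr quotient_cycle ?(subsetP nbA).
Qed.

Lemma card_quotient_complement : #|A / <[b]>| = #[a].
Proof.
have nB : <[b]> <| A by rewrite -sub_abelian_normal.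
by rewrite -(divg_normal nB) oA -[#|<[b]>|]/(#[b]) mulnK ?order_gt0.
Qed.

(** Modulo <[b]> only the exponent of a survives, and A / <[b]> is cyclic of
    order #[a] with generator the class of a. *)
Lemma coset_number_complement i j :
  coset_number A <[b]> a (a ^+ i * b ^+ j) = absmod #[a] i.
Proof.
have gen := generator_complement; have oq := card_quotient_complement.
have Ah : a ^+ i * b ^+ j \in A by rewrite groupM ?groupX.
have oa : #[coset <[b]> a] = #[a] by rewrite orderE -(eqP gen) oq.
apply: (coset_number_unique abA sbA Aa Ah gen); first exact: coset_numberP.
rewrite is_coset_numberE // oq absmod_half ?order_gt0 //=.
rewrite coset_kerr ?mem_cycle // morphX ?(subsetP nbA) //.
have [e|e] := absmodP i (order_gt0 a).
  by rewrite eq_expg_mod_order oa e eqxx.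
apply/orP; right; rewrite eq_sym eq_invg_mul -expgD.
by rewrite -order_dvdn oa addnC.
Qed.

End Complement.

(** * Coordinates on A *)

Section Frame.
Variables (gT : finGroupType) (A : {group gT}) (e d : nat).
Hypotheses (abA : abelian A) (oe : odd e) (od : odd d).
Hypothesis oA : #|A| = (4 * (e * d))%N.

(** Coordinates on A, which has order 4ed: s1 and s2 generate the involutions, x
    and b the odd part.  Only divisibility of the orders is asked for, since the
    generation of A and its cardinality make them exact. *)
Definition frame (s1 s2 x b : gT) :=
  [/\ [/\ s1 \in A, s2 \in A, x \in A & b \in A],
      [/\ s1 ^+ 2 = 1, s2 ^+ 2 = 1, x ^+ e = 1 & b ^+ d = 1]
    & A \subset <<[set s1; s2; x; b]>>].

Let comA x y : x \in A -> y \in A -> commute x y.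
Proof. by move=> Ax Ay; apply: (centsP abA). Qed.

Lemma frame_swap s1 s2 x b : frame s1 s2 x b -> frame s2 s1 x b.
Proof. by case=> [[? ? ? ?] [? ? ? ?]]; rewrite (setUC [set s1]). Qed.

Lemma frame_mul s1 s2 x b : frame s1 s2 x b -> frame s1 (s1 * s2) x b.
Proof.
case=> [[A1 A2 Ax Ab] [o1 o2 ox ob] sA].
split; [split | split |] => //; first exact: groupM.
  by rewrite expgMn ?o1 ?o2 ?mulg1 //; apply: comA.
apply: subset_trans sA _; set S := [set s1; s1 * s2; x; b].
have gen z : z \in S -> z \in <<S>> by apply: mem_gen.
rewrite gen_subG !subUset !sub1set.
have -> : s2 \in <<S>>.
  by rewrite -(mulKg s1 s2) groupM ?groupV // gen // !inE eqxx ?orbT.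
by rewrite !gen // !inE eqxx ?orbT.
Qed.

(** A change of generator of <[x]>: passing to an n-th root multiplies the
    exponents of x by n. *)
Lemma frame_root n s1 s2 x b : coprime n e -> frame s1 s2 x b ->
  exists2 z, z ^+ n = x & frame s1 s2 z b.
Proof.
move=> co [[A1 A2 Ax Ab] [o1 o2 ox ob] sA].
(* e divides 1 + m * n, so that - m is the inverse of n modulo e. *)
have [m _] := Bezoutl n (odd_gt0 oe).
rewrite gcdnC (eqP co) => /dvdnP[q dm].
have zx : x ^- m ^+ n = x.
  apply/eqP; rewrite expgVn -expgM eq_invg_mul -expgSr -add1n dm.
  by rewrite mulnC expgM ox expg1n.
exists (x ^- m) => //; split; [split | split |] => //.
- by rewrite groupV groupX.
- by rewrite expgVn -expgM mulnC expgM ox expg1n invg1.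
apply: subset_trans sA _; rewrite gen_subG !subUset !sub1set.
have -> : x \in <<[set s1; s2; x ^- m; b]>>.
  by rewrite -[X in X \in _]zx groupX ?mem_gen // !inE eqxx ?orbT.
by rewrite !mem_gen // !inE eqxx ?orbT.
Qed.

(** As s1 has order 2 and x odd order, both are powers of s1 * x, and likewise
    for s2 * b.  The product of two cyclic groups thus covers A, and counting
    shows that their orders are as large as possible. *)
Lemma frame_split s1 s2 x b (a := s1 * x) (c := s2 * b) : frame s1 s2 x b ->
  [/\ A \subset <[a]> * <[c]>, #[a] = e.*2 & #[c] = d.*2].
Proof.
case=> [[A1 A2 Ax Ab] [o1 o2 ox ob] sA].
have half (s z : gT) n :
    s \in A -> z \in A -> s ^+ 2 = 1 -> z ^+ n = 1 -> odd n ->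
    [/\ s \in <[s * z]>, z \in <[s * z]> & #[s * z] <= n.*2].
  move=> As Az os oz on; have com := comA As Az.
  have es m : s ^+ m = s ^+ odd m by rewrite -modn2 expg_mod.
  have -> : #[s * z] <= n.*2.
    rewrite dvdn_leq ?double_gt0 ?odd_gt0 // order_dvdn expgMn // es odd_double.
    by rewrite -muln2 expgM oz expg1n mulg1.
  split=> //; apply/cycleP.
    by exists n; rewrite expgMn // es on oz mulg1.
  by exists n.+1; rewrite expgMn // es /= on expgS oz mulg1 mul1g.
have [a1 ax oa] := half _ _ _ A1 Ax o1 ox oe.
have [c2 cb oc] := half _ _ _ A2 Ab o2 ob od.
have Aa : a \in A by rewrite groupM.
have Ac : c \in A by rewrite groupM.
have sAac : A \subset <[a]> * <[c]>.
  have cac : <[c]> \subset 'N(<[a]>).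
    by apply: subset_trans (sub_abelian_norm abA _); rewrite cycle_subG.
  rewrite -norm_joinEr //.
  apply: subset_trans sA _; rewrite gen_subG !subUset !sub1set.
  by rewrite !mem_gen // inE ?a1 ?ax ?c2 ?cb ?orbT.
have := subset_leq_card sAac; have := mul_cardG <[a]> <[c]>.
rewrite oA -!orderE; have := cardG_gt0 (<[a]> :&: <[c]>).
move: (#|<[a]> :&: <[c]>|) (#|<[a]> * <[c]>|) => i m i0.
move: (#[a]) (#[c]) oa oc => p q lp lq E lm.
have le_pq : (e.*2 * d.*2 <= p * q)%N.
  rewrite -doubleMl -doubleMr -2!mul2n mulnA.
  by rewrite E (leq_trans lm) // leq_pmulr.
have e2 : 0 < e.*2 by rewrite double_gt0 odd_gt0.
have d2 : 0 < d.*2 by rewrite double_gt0 odd_gt0.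
split=> //; apply/eqP; rewrite eqn_leq ?lp ?lq /=.
  by rewrite -(leq_pmul2r d2) (leq_trans le_pq) // leq_mul2l lq orbT.
by rewrite -(leq_pmul2l e2) (leq_trans le_pq) // leq_mul2r lp orbT.
Qed.

(** The exponent of x is taken even because (s1 * x) ^+ c equals
    s1 ^+ p * x ^+ (2 * i) for c = 2 * i + p * e. *)
Lemma frame_coset_number s1 s2 x b (p q : bool) i j : frame s1 s2 x b ->
  coset_number A <[s2 * b]> (s1 * x) (s1 ^+ p * s2 ^+ q * x ^+ (2 * i) * b ^+ j)
  = level e p (absmod e i).
Proof.
move=> F; have [sA oa oc] := frame_split F.
case: F => [[A1 A2 Ax Ab] [o1 o2 ox ob] _].
have par s m : s ^+ 2 = 1 -> s ^+ m = s ^+ odd m :> gT.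
  by move=> os; rewrite -modn2 expg_mod.
(* The multiple of d adjusts the parity of the exponent of s2 * b to q and does
   not change the power of b. *)
have dec : s1 ^+ p * s2 ^+ q * x ^+ (2 * i) * b ^+ j =
    (s1 * x) ^+ (i.*2 + p * e) * (s2 * b) ^+ (j + (q (+) odd j) * d).
  rewrite mul2n !expgMn; try exact: comA.
  rewrite (par s1 (i.*2 + p * e)%N) // (par s2 (_ + _ * d)%N) //.
  rewrite !oddD !oddM odd_double oe od /= !andbT !oddb addbC addbK.
  rewrite !expgD -!(mulnC e) -!(mulnC d) !expgM ox ob !expg1n !mulg1.
  rewrite -!mulgA; congr (_ * _); rewrite !mulgA; congr (_ * _).
  by apply: comA; rewrite groupX.
rewrite dec coset_number_complement ?groupM //; last first.
  by rewrite oa oc oA -doubleMl -doubleMr -2!mul2n (mulnA 2 2).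
by rewrite oa absmod_level.
Qed.

Lemma frame_coords s1 s2 x b g : frame s1 s2 x b -> g \in A ->
  exists u : bool * bool, exists i j,
    g = s1 ^+ u.1 * s2 ^+ u.2 * x ^+ (2 * i) * b ^+ j.
Proof.
move=> F; have [sA oa oc] := frame_split F.
case: F => [[A1 A2 Ax Ab] [o1 o2 ox ob] _].
have par s m : s ^+ 2 = 1 -> s ^+ m = s ^+ odd m :> gT.
  by move=> os; rewrite -modn2 expg_mod.
move=> /(subsetP sA)/mulsgP[_ _ /cycleP[m ->] /cycleP[n ->] ->].
(* e.+1./2 is the inverse of 2 modulo e. *)
exists (odd m, odd n), (m * e.+1./2)%N, n => /=.
rewrite !expgMn; try exact: comA.
have -> : (2 * (m * e.+1./2) = e * m + m)%N.
  by rewrite mulnCA mul2n halfK /= oe mulnS mulnC addnC; lia.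
rewrite expgD expgM ox expg1n mul1g -(par s1) // -(par s2) //.
rewrite -!mulgA; congr (_ * _); rewrite !mulgA; congr (_ * _).
by apply: comA; rewrite groupX.
Qed.

(** Elements with the same involution part and the same |i| have images modulo
    <[b]> that are equal or inverse to each other. *)
Lemma frame_absmod_eq s1 s2 x b (u : bool * bool) i i' j j' : frame s1 s2 x b ->
    absmod e i = absmod e i' ->
    let g i j := s1 ^+ u.1 * s2 ^+ u.2 * x ^+ (2 * i) * b ^+ j in
  g i j * (g i' j')^-1 \in <[b]> \/ g i j * g i' j' \in <[b]>.
Proof.
case=> [[A1 A2 Ax Ab] [o1 o2 ox _] _] eabs g.
pose w := s1 ^+ u.1 * s2 ^+ u.2.
have [Aw AX] : w \in A /\ (forall m, x ^+ m \in A).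
  by split=> [|m]; rewrite !(groupM, groupX).
have w2 : w * w = 1.
  rewrite -[w * w]/(w ^+ 2) expgMn; last by apply: comA; rewrite groupX.
  by rewrite -!expgM !(mulnC _ 2) !expgM o1 o2 !expg1n mulg1.
have e0 := odd_gt0 oe; rewrite {}/g -/w; move: w Aw w2 => w Aw w2.
have [eii|eii] := absmod_inj e0 eabs; [left | right].
  have ex : x ^+ (2 * i) = x ^+ (2 * i').
    by rewrite -(expg_mod (2 * i) ox) -modnMmr eii modnMmr expg_mod.
  have cwb : commute (w * x ^+ (2 * i')) (b ^+ j * b ^- j').
    by apply: comA; rewrite !groupM ?groupV ?groupX.
  rewrite ex; move: (w * _) cwb => v cvb.
  rewrite invMg !mulgA -(mulgA v) cvb mulgK.
  by rewrite groupM ?groupV ?mem_cycle.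
have ex : x ^+ (2 * i) * x ^+ (2 * i') = 1.
  case/dvdnP: eii => q eii; rewrite -expgD -mulnDr eii mulnA mulnC expgM.
  by rewrite ox expg1n.
have cb : commute (b ^+ j) (w * x ^+ (2 * i')).
  by apply: comA; rewrite ?groupM ?groupX.
rewrite -mulgA [X in _ * X]mulgA cb -!mulgA (mulgA (x ^+ _) w).
rewrite (comA (AX _) Aw) !mulgA w2 mul1g ex mul1g.
by rewrite groupM ?mem_cycle.
Qed.

(** For each nontrivial character of the Klein four-group, the first two members
    of the frame are replaced by t1, t2, where t2 generates the kernel of the
    character and t1 is outside it; the coset numbers relative to <[t2 * b]> and
    t1 * z are then the levels given by this character. *)
Lemma frame_coords_collide s1 s2 x b (h : 'I_4 -> gT)
    (u : 'I_4 -> bool * bool) i j :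
    coprime 3 e -> frame s1 s2 x b ->
    (forall B : {group gT}, B \subset A -> cyclic B -> cyclic (A / B) ->
     forall a, a \in A -> generator (A / B) (coset B a) ->
     nth 0%N (coset_numbers A B a h) 1%N = nth 0%N (coset_numbers A B a h) 2) ->
    (forall k,
       h k = s1 ^+ (u k).1 * s2 ^+ (u k).2 * x ^+ (2 * i k) * b ^+ j k) ->
  ~ forall k l, u k = u l -> absmod e (i k) = absmod e (i l) -> k = l.
Proof.
move=> co3 F H eh inj; apply: (not_all_balanced oe co3 inj) => s n s0 con.
have [z ezx {F}F] := frame_root con F.
have main t1 t2 (t w : 'I_4 -> bool) : frame t1 t2 z b ->
    (forall k, s1 ^+ (u k).1 * s2 ^+ (u k).2 = t1 ^+ t k * t2 ^+ w k) ->
    balanced (fun k => level e (t k) (absmod e (n * i k))).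
  move=> F' e12; have [sA oa oc] := frame_split F'.
  have [[A1 A2 Az Ab] _ _] := F'.
  have gen : generator (A / <[t2 * b]>) (coset <[t2 * b]> (t1 * z)).
    by apply: generator_complement; rewrite ?groupM.
  have cyq : cyclic (A / <[t2 * b]>) by rewrite (eqP gen) cycle_cyclic.
  have sB : <[t2 * b]> \subset A by rewrite cycle_subG groupM.
  have /balanced_sorted := H _ sB (cycle_cyclic _) cyq _ (groupM A1 Az) gen.
  case=> m hm; exists m; move: hm.
  have E k : coset_number A <[t2 * b]> (t1 * z) (h k) =
      level e (t k) (absmod e (n * i k)).
    by rewrite eh e12 -ezx -expgM mulnCA frame_coset_number.
  under eq_bigr do rewrite E.
  by under [X in _ /\ X <= _ -> _]eq_bigr do rewrite E.
have [[A1 A2 _ _] [o1 o2 _ _] _] := F.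
case: s s0 => [[] []] // _.
- apply: (main s1 (s1 * s2) (fun k => chi (true, true) (u k))
                          (fun k => (u k).2)); first exact: frame_mul.
  move=> k; rewrite /chi /=; case: (u k) => [[] []] /=;
    rewrite ?expg0 ?expg1 ?mulg1 ?mul1g //.
  by rewrite mulgA -[s1 * s1]/(s1 ^+ 2) o1 mul1g.
- apply: (main s1 s2 (fun k => chi (true, false) (u k))
                     (fun k => (u k).2)) => // k.
  by rewrite /chi /= addbF.
- apply: (main s2 s1 (fun k => chi (false, true) (u k))
                     (fun k => (u k).1)) => [|k]; first exact: frame_swap.
  by rewrite /chi /=; apply: comA; rewrite groupX.
Qed.

End Frame.

(** * A cyclic subgroup avoiding twelve elements *)

(** If every member of the family met G, choosing a point in each intersection
    would embed I into G. *)
Lemma exists_disjoint_member (T I : finType) (K : I -> {set T}) (G : {set T}) :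
    (forall i j g, i != j -> g \in K i -> g \in K j -> g \notin G) ->
    #|G| < #|I| -> exists i, [disjoint K i & G].
Proof.
move=> KG ltGI; apply/existsP; apply: contraLR ltGI => /existsPn meet.
have /fin_all_exists[g gP] i : exists g, (g \in K i) && (g \in G).
  by case/pred0Pn: (meet i) => g; exists g.
rewrite -leqNgt -(card_codom (f := g)).
  by apply/subset_leq_card/subsetP => _ /codomP[i ->]; case/andP: (gP i).
move=> i j eg; apply: contraTeq (proj2 (andP (gP i))) => nij.
by apply: (KG i j) => //; [case/andP: (gP i) | rewrite eg; case/andP: (gP j)].
Qed.

(** There are 6 quotients and 6 products to avoid.  Both are indexed by the
    ordered pairs of distinct indices, which are the pairs (k, lift k j): a
    quotient if the pair is increasing, a product otherwise. *)
Lemma avoid_sums_differences (gT : finGroupType) (A : {group gT})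
    (h : 'I_4 -> gT) (K : 'I_13 -> {group gT}) :
    abelian A -> (forall k, h k \in A) ->
    (forall k l, k != l -> h k != h l /\ h k != (h l)^-1) ->
    (forall s t : 'I_13, s < t -> K s :&: K t = 1) ->
  exists t, forall k l, k != l ->
    h k * (h l)^-1 \notin K t /\ h k * h l \notin K t.
Proof.
move=> abA Ah hne tiK.
pose g (k l : 'I_4) := h k * (if k < l then (h l)^-1 else h l).
pose G := [set g q.1 (lift q.1 q.2) | q : 'I_4 * 'I_3].
have [t tG] : exists t, [disjoint K t & G].
  apply: exists_disjoint_member; last first.
    by rewrite (leq_ltn_trans (leq_imset_card _ _)) // card_prod !card_ord.
  move=> s t z nst zs zt; have -> : z = 1.
    apply/set1P; case: (ltngtP s t) nst => [lt|gt|/val_inj->];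
      last by rewrite eqxx.
      by rewrite -[[set 1]](tiK s t) // inE zs.
    by rewrite -[[set 1]](tiK t s) // inE zt.
  apply/imsetP=> -[[k j] _ /esym/eqP]; rewrite /g /=.
  have [ne nei] := hne _ _ (neq_lift k j).
  case: ifP => _; first by rewrite -eq_mulgV1 (negbTE ne).
  by rewrite -eq_invg_mul eq_invg_sym (negbTE nei).
have gK k l : k != l -> g k l \notin K t.
  case/unlift_some=> j -> _; rewrite (disjointFl tG) //.
  by apply/imsetP; exists (k, j).
exists t => k l nkl; have := gK k l nkl.
have := gK l k; rewrite eq_sym /g => /(_ nkl).
have com : h k * h l = h l * h k by apply: (centsP abA).
case: ltngtP nkl => [lt|gt|/val_inj->] nkl /= h1 h2;
  last by rewrite eqxx in nkl.
  by split=> //; rewrite -groupV invMg invgK.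
by rewrite com.
Qed.

(** The subgroups generated by the elements x ^+ (r * t) * y are the graphs of
    homomorphisms from <[y]> to <[x]>. *)
Section Family.
Variables (gT : finGroupType) (x y : gT) (d r : nat).
Hypotheses (cxy : commute x y) (tixy : <[x]> :&: <[y]> = 1).
Hypotheses (oy : #[y] = d) (ox : #[x] = (r * d)%N).

Lemma twist_order t : (x ^+ (r * t) * y) ^+ d = 1.
Proof.
rewrite expgMn; last exact/commute_sym/commuteX/commute_sym.
by rewrite -{2}oy expg_order mulg1 -expgM mulnAC expgM -ox expg_order expg1n.
Qed.

(** Graphs of two homomorphisms meet where the homomorphisms agree, and these
    differ by y |-> x ^+ (r * (s - t)), which is injective when s - t is prime
    to d. *)
Lemma twist_meet t s g : t < s -> coprime (s - t) d ->
  g \in <[x ^+ (r * t) * y]> -> g \in <[x ^+ (r * s) * y]> -> g = 1.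
Proof.
move=> lts co /cycleP[m ->] /cycleP[n]; have r0 : 0 < r.
  by have := order_gt0 x; rewrite ox muln_gt0 => /andP[].
have com k : commute (x ^+ k) y by apply/commute_sym/commuteX/commute_sym.
move=> eg; have E : x ^+ (r * t * m) * y ^+ m = x ^+ (r * s * n) * y ^+ n.
  by rewrite 2!(expgM _ (_ * _)%N) -!expgMn.
have : x ^- (r * s * n) * x ^+ (r * t * m) = y ^+ n * y ^- m.
  by apply: (mulIg (y ^+ m)); rewrite mulgKV -mulgA E mulKg.
move=> E'; have : x ^- (r * s * n) * x ^+ (r * t * m) \in <[x]> :&: <[y]>.
  rewrite inE {2}E' !groupM ?groupV ?mem_cycle //.
rewrite tixy => /set1P e1; move: E'; rewrite e1 => /esym/eqP.
rewrite -eq_mulgV1 eq_sym eq_expg_mod_order oy => /eqP emn.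
move/eqP: e1; rewrite -eq_invg_mul invgK eq_sym eq_expg_mod_order ox.
rewrite -!mulnA -!muln_modr eqn_pmul2l // eq_sym.
rewrite -[X in X == _]modnMmr -emn modnMmr.
rewrite eqn_mod_dvd ?leq_mul2r ?(ltnW lts) ?orbT // -mulnBl.
rewrite Gauss_dvdr 1?coprime_sym // => /dvdnP[q ->].
by rewrite (mulnC q) expgM twist_order expg1n.
Qed.

End Family.

(** * Structure of A *)

Lemma abelian_gen2 (gT : finGroupType) (A : {group gT}) x y :
    abelian A -> <<[set x; y]>> = A ->
  exists X Y, <[X]> \x <[Y]> = A /\ #[Y] %| #[X].
Proof.
move=> abA genA; have [b defA otype] := abelian_structure abA.
have size_b : size b <= 2.
  rewrite -(size_map order) otype size_abelian_type // -grank_abelian // -genA.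
  by apply: leq_trans (grank_min _) _; rewrite cards2; case: (_ != _).
have := abelian_type_dvdn_sorted A; rewrite -otype.
case: b size_b defA {otype} => [|X [|Y [|]]] //= _; rewrite ?big_cons big_nil.
- by move=> defA _; exists 1, 1; rewrite cycle1 dprodg1.
- by move=> defA _; exists X, 1; rewrite cycle1 defA order1 dvd1n.
by rewrite dprodg1 andbT => defA ?; exists X, Y.
Qed.

(** If Y had odd order it would be a square, and A / squares A would be
    generated by the class of X, whose square is trivial. *)
Lemma even_order_factor (gT : finGroupType) (A : {group gT}) X Y :
    <[X]> \x <[Y]> = A -> abelian A -> 2 < #|A / squares A| -> ~~ odd #[Y].
Proof.
move=> defA abA; rewrite ltnNge; apply: contra => oddY.
have [_ mulXY _ _] := dprodP defA.
have AX : X \in A.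
  by rewrite -mulXY -[X in X \in _]mulg1 mem_mulg ?cycle_id ?group1.
have sq z : z \in A -> z ^+ 2 \in squares A by move=> Az; exact/mem_gen/imset_f.
have sqY : <[Y]> \subset squares A.
  have -> : Y = Y ^+ #[Y].+1./2 ^+ 2.
    by rewrite -expgM muln2 halfK /= oddY subn0 expgS expg_order mulg1.
  rewrite cycle_subG sq // groupX //.
  by rewrite -mulXY -[X in X \in _]mul1g mem_mulg ?cycle_id ?group1.
have sSA : squares A \subset A.
  by rewrite gen_subG; apply/subsetP => _ /imsetP[z Az ->]; rewrite groupX.
move: sq sqY sSA; have [S ->] : exists S : {group gT}, squares A = S.
  by exists <<[set z ^+ 2 | z in A]>>%G.
move=> sq sYS sSA; have nSA : A \subset 'N(S) by apply: sub_abelian_norm sSA.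
have -> : A / S = <[coset S X]>.
  apply/eqP; rewrite eqEsubset cycle_subG mem_quotient ?andbT //.
  apply/subsetP=> _ /morphimP[z _ Az ->].
  move: Az; rewrite -mulXY => /mulsgP[_ v /cycleP[m ->] Yv ->].
  by rewrite /= coset_kerr ?(subsetP sYS) // morphX ?(subsetP nSA) // mem_cycle.
rewrite -orderE dvdn_leq // order_dvdn -morphX ?(subsetP nSA) //.
by rewrite /= coset_id ?sq.
Qed.

Lemma coprime_small (n : nat) (p k : 'I_n -> nat) m :
    (forall i, prime (p i)) -> (forall i, 13 <= p i) ->
  0 < m < 13 -> coprime m (\prod_(i < n) p i ^ k i).
Proof.
move=> pr ge13 /andP[m0 m13].
apply: (big_ind (coprime m)) => [|u v cu cv|i _]; first exact: coprimen1.
  by rewrite coprimeMr cu.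
apply: coprimeXr; rewrite coprime_sym prime_coprime // gtnNdvd //.
exact: leq_trans (ge13 i).
Qed.

Lemma even_order_recover (gT : finGroupType) (Z : gT) m :
  odd m -> #[Z] = m.*2 -> Z = Z ^+ m * (Z ^+ 2) ^+ m.+1./2.
Proof.
move=> om oZ; rewrite -expgM -expgD mul2n halfK /= om subn0.
by rewrite addnS addnn -oZ expgS expg_order mulg1.
Qed.

(** The odd parts of <[X]> and <[Y]> are generated by X ^+ 2 and Y ^+ 2, and
    (X ^+ 2) ^+ (r * t) has order dividing d. *)
Lemma twisted_frame (gT : finGroupType) (A : {group gT}) X Y e d r t :
    abelian A -> <[X]> \x <[Y]> = A -> odd e -> odd d ->
    #[X] = e.*2 -> #[Y] = d.*2 -> e = (r * d)%N ->
  frame A e d (X ^+ e) (Y ^+ d) (X ^+ 2) ((X ^+ 2) ^+ (r * t) * Y ^+ 2).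
Proof.
move=> abA defA oe od oX oY e_rd; have [_ mulXY _ _] := dprodP defA.
have [AX AY] : X \in A /\ Y \in A.
  by rewrite -mulXY -{1}[X]mulg1 -{2}[Y]mul1g !mem_mulg ?cycle_id.
set b := _ * Y ^+ 2; pose S := [set X ^+ e; Y ^+ d; X ^+ 2; b].
have gen z : z \in S -> z \in <<S>> by apply: mem_gen.
have [g1 g2 gx gb] :
    [/\ X ^+ e \in <<S>>, Y ^+ d \in <<S>>, X ^+ 2 \in <<S>> & b \in <<S>>].
  by split; apply: gen; rewrite !inE eqxx ?orbT.
split; [split | split |]; rewrite ?groupM ?groupX //.
- by rewrite -expgM muln2 -oX expg_order.
- by rewrite -expgM muln2 -oY expg_order.
- by rewrite -expgM mul2n -oX expg_order.
- rewrite expgMn; last by apply: (centsP abA); rewrite !groupX.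
  have e_rtd : (2 * (r * t * d) = e.*2 * t)%N.
    by rewrite e_rd -mul2n -!mulnA (mulnC t).
  rewrite -!expgM e_rtd mul2n -oX -oY expg_order expgM expg_order.
  by rewrite expg1n mulg1.
rewrite -mulXY mul_subG // cycle_subG.
  by rewrite [Z in Z \in _](even_order_recover oe oX) groupM // groupX.
rewrite [Z in Z \in _](even_order_recover od oY) groupM // groupX //.
by rewrite -[Z in Z \in _](mulKg ((X ^+ 2) ^+ (r * t))) groupM // groupV groupX.
Qed.

Theorem theorem1p3 (gT : finGroupType) (A : {group gT})
  (abA : abelian A)
  (gen2 : exists x y : gT, <<[set x; y]>> = A)
  (A2 : A / squares A \isog [set: 'Z_2 * 'Z_2])
  (n : nat) (p k : 'I_n -> nat)
  (p_prime : forall i, prime (p i))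
  (p_ge13 : forall i, 13 <= p i)
  (cardA : #|A| = (4 * \prod_(i < n) p i ^ k i)%N)
  (k_ge1 : (1 <= \sum_(i < n) k i)%N) :
  ~ exists H : {set gT}, nonseparating A H.
Proof.
case=> H [sHA [h [defH disj] medians]].
have [x0 [y0 genA]] := gen2.
have [X [Y [defA dvdYX]]] := abelian_gen2 abA genA.
have [_ mulXY cXY tiXY] := dprodP defA.
have evY : ~~ odd #[Y].
  apply: (even_order_factor defA abA).
  by rewrite (card_isog A2) cardsT card_prod !card_ord.
have evX : ~~ odd #[X] by apply: contra evY => /(dvdn_odd dvdYX).
pose e := #[X]./2; pose d := #[Y]./2.
have oX : #[X] = e.*2 by rewrite halfK (negbTE evX) subn0.
have oY : #[Y] = d.*2 by rewrite halfK (negbTE evY) subn0.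
have oA : #|A| = (4 * (e * d))%N.
  rewrite -(dprod_card defA) -!orderE oX oY.
  by rewrite -doubleMl -doubleMr -2!mul2n mulnA.
have small m : 0 < m < 13 -> coprime m (e * d).
  move=> hm; have -> : (e * d = \prod_(i < n) p i ^ k i)%N.
    by apply/eqP; rewrite -(eqn_pmul2l (m := 4)) // -oA cardA.
  exact: coprime_small.
have [oe od] : odd e /\ odd d.
  by apply/andP; rewrite -oddM -coprime2n small.
have co3e : coprime 3 e by have := small 3 isT; rewrite coprimeMr => /andP[].
have e_rd : e = (e %/ d * d)%N.
  by rewrite divnK // -(dvdn_pmul2l (p := 2)) // !mul2n -oX -oY.
pose r := (e %/ d)%N; pose x := X ^+ 2; pose b t := x ^+ (r * t) * Y ^+ 2.
have frame_b t : frame A e d (X ^+ e) (Y ^+ d) x (b t) by apply: twisted_frame.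
have ox : #[x] = (r * d)%N.
  by rewrite -e_rd orderXdiv oX -muln2 ?mulnK ?dvdn_mull.
have oy : #[Y ^+ 2] = d by rewrite orderXdiv oY -muln2 ?mulnK ?dvdn_mull.
have cxy : commute x (Y ^+ 2).
  by apply/commuteX/commute_sym/commuteX/(centsP cXY); apply: cycle_id.
have tixy : <[x]> :&: <[Y ^+ 2]> = 1.
  by apply/trivgP; rewrite -tiXY setISS // cycle_subG mem_cycle.
have Ah k' : h k' \in A.
  apply/(subsetP sHA); rewrite defH; apply/bigcupP; exists k' => //.
  by rewrite !inE eqxx.
have hne k' l : k' != l -> h k' != h l /\ h k' != (h l)^-1.
  by move=> /disj/pred0P/(_ (h k')); rewrite /= !inE eqxx /= => /norP.
have [s t lt_st|t notb] :=
    avoid_sums_differences (K := fun t : 'I_13 => <[b t]>%G) abA Ah hne.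
  apply/trivgP/subsetP=> z /setIP[zs zt]; apply/set1P.
  apply: (twist_meet cxy tixy oy ox lt_st _ zs zt).
  have := small (t - s)%N; rewrite coprimeMr subn_gt0 lt_st.
  by rewrite (leq_ltn_trans (leq_subr _ _)) // => /(_ isT)/andP[].
have /fin_all_exists[u /fin_all_exists[i /fin_all_exists[j hE]]] :=
  fun k' => frame_coords abA oe od oA (frame_b t) (Ah k').
apply: (frame_coords_collide abA oe od oA co3e (frame_b t) medians hE).
move=> k' l eu ef; apply/eqP/negPn/negP => /notb[].
rewrite !hE eu.
by case: (frame_absmod_eq abA oe (u l) (j k') (j l) (frame_b t) ef) => ->.
Qed.
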